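(* Let $(X_t)_{t\ge0}$ be a standard quadratic harness. Suppose that $1,\ X_r,\ X_u,\ X_rX_u,\ X_r^2,\ X_u^2$ are linearly independent for all $0<r<u$ as functions on $\Omega$. Then there exist constants $\chi\in\{0,1\}$, $\sigma\ge0$, $\tau\ge0$, $\gamma\le\chi+2\sqrt{\sigma\tau}$ and $\eta,\theta\in\mathbb{R}$ such that $\gamma,\sigma,\tau,\chi$ are not all zero and, for all $0<r<s<u$, $$\mathrm{Var}(X_s\mid\mathcal{F}_{r,u})=\frac{(s-r)(u-s)}{c_{\tau,\sigma,\gamma,\chi}(r,u)}\;Q_{\theta,\eta,\tau,\sigma,\gamma-\chi,\chi}\!\left(\frac{X_u-X_r}{u-r},\frac{uX_r-rX_u}{u-r}\right),$$ where $$c_{\tau,\sigma,\gamma,\chi}(r,u)=\tau+\sigma ru-\gamma r+\chi u$$ and $$Q_{\theta,\eta,\tau,\sigma,\rho,\chi}(x,y)=\tau x^2+\sigma y^2+\rho xy+\theta x+\eta y+\chi.$$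
   Context: For a real-valued stochastic process $(X_t)_{t\ge0}$ on a probability space $(\Omega,\mathcal{F},\mathbb{P})$, $\mathcal{F}_{r,u}$ denotes the complete $\sigma$-field generated by $\{X_t: t\in[0,r]\cup[u,\infty)\}$, $0\le r<u$. Conditional variance is $\mathrm{Var}(X_s|\mathcal{F}_{r,u})=\mathbb{E}(X_s^2|\mathcal{F}_{r,u})-[\mathbb{E}(X_s|\mathcal{F}_{r,u})]^2$. Equalities between random variables are almost sure, and linear independence is understood for random variables modulo almost sure equality. A separable integrable process is a harness if for all $0\le r<s<u$ $$\mathbb{E}(X_s|\mathcal{F}_{r,u})=\tfrac{u-s}{u-r}X_r+\tfrac{s-r}{u-r}X_u.$$ A separable square-integrable process $(X_t)_{t\ge0}$ is a standard quadratic harness if it is a harness, $\mathbb{E}X_t=0$ and $\mathbb{E}X_sX_t=s\wedge t$ for all $s,t\ge0$, and for all $0\le r<s<u$ $$\mathbb{E}(X_s^2|\mathcal{F}_{r,u})=A_{sru}X_r^2+B_{sru}X_rX_u+C_{sru}X_u^2+D_{sru}X_r+E_{sru}X_u+F_{sru}$$ with deterministic coefficients $A_{sru},\dots,F_{sru}$ depending only on $r,s,u$. *)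

(* Defs.v *)
From HB Require Import structures.
From mathcomp Require Import all_boot all_order all_algebra.
From mathcomp Require Import all_classical all_reals all_analysis.
Set Implicit Arguments.
Unset Strict Implicit.
Unset Printing Implicit Defensive.
Import Order.TTheory GRing.Theory Num.Theory.
Import numFieldNormedType.Exports.
Local Open Scope classical_set_scope.
Local Open Scope ring_scope.

(* A process (X_t)_{t >= 0} is a family X : R -> {RV P >-> R} of which only
   the members with 0 <= t are ever used; the others are irrelevant. *)

Section conditioning.
Context {d : measure_display} {T : measurableType d} {R : realType}.
Variable P : probability T R.

(* Completion is relative to the ambient sigma-algebra: all measurable
   P-null sets are added (all negligible sets, when P is complete), so that
   the result is always a sub-sigma-algebra of the measurable sets. *)
Definition two_sided_sigma_field (X : R -> {RV P >-> R}) (r u : R) :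
    set (set T) :=
  <<s [set A | exists t (B : set R),
        [/\ 0 <= t <= r \/ u <= t, measurable B & A = X t @^-1` B]]
      `|` [set N | measurable N /\ P N = 0%E] >>.

(* Y is a version of E(Z | F), for F a sub-sigma-algebra of the measurable
   sets. *)
Definition is_cond_exp (F : set (set T)) (Z Y : T -> R) : Prop :=
  [/\ P.-integrable setT (EFin \o Z),
      P.-integrable setT (EFin \o Y),
      (forall B : set R, measurable B -> F (Y @^-1` B)) &
      (forall A, F A ->
         (\int[P]_(w in A) (Y w)%:E = \int[P]_(w in A) (Z w)%:E)%E)].

(* V is almost surely equal to E(Z^2 | F) - E(Z | F)^2. *)
Definition is_cond_var (F : set (set T)) (Z V : T -> R) : Prop :=
  exists M1 M2 : T -> R,
    [/\ is_cond_exp F Z M1,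
        is_cond_exp F (fun w => Z w ^+ 2) M2 &
        {ae P, forall w, V w = M2 w - M1 w ^+ 2}].

Definition ae_lin_indep (n : nat) (f : n.-tuple (T -> R)) : Prop :=
  forall a : 'I_n -> R,
    {ae P, forall w, \sum_(i < n) a i * tnth f i w = 0} ->
    forall i, a i = 0.

(* Doob separability, relative to closed sets. *)
Definition separable_process (X : R -> {RV P >-> R}) : Prop :=
  exists (S : set R) (N : set T),
    [/\ countable S, S `<=` [set t | 0 <= t],
        [set t | 0 <= t] `<=` closure S, P.-negligible N &
        forall (G K : set R) (w : T), open G -> closed K -> ~ N w ->
          (forall t, S t -> G t -> K (X t w)) ->
          forall t, 0 <= t -> G t -> K (X t w)].

Definition harness (X : R -> {RV P >-> R}) : Prop :=
  [/\ separable_process X,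
      (forall t, 0 <= t -> P.-integrable setT (EFin \o X t)) &
      (forall r s u, 0 <= r -> r < s -> s < u ->
         is_cond_exp (two_sided_sigma_field X r u) (X s)
           (fun w => (u - s) / (u - r) * X r w + (s - r) / (u - r) * X u w))].

Definition standard_quadratic_harness (X : R -> {RV P >-> R}) : Prop :=
  [/\ harness X,
      (forall t, 0 <= t ->
         P.-integrable setT (EFin \o (fun w => X t w ^+ 2))),
      (forall t, 0 <= t -> ('E_P[X t] = 0)%E),
      (forall s t, 0 <= s -> 0 <= t ->
         ('E_P[fun w => (X s w * X t w)%R] = (Num.min s t)%:E)%E) &
      (exists A B C D E F : R -> R -> R -> R,
         forall r s u, 0 <= r -> r < s -> s < u ->
           is_cond_exp (two_sided_sigma_field X r u) (fun w => X s w ^+ 2)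
             (fun w => A s r u * X r w ^+ 2 + B s r u * (X r w * X u w) +
                       C s r u * X u w ^+ 2 + D s r u * X r w +
                       E s r u * X u w + F s r u))].

End conditioning.

(* If 0 < r < u, 0 <= chi, sigma, tau, gamma <= chi + 2 sqrt (sigma tau) and
   (gamma, sigma, tau, chi) <> 0, this is positive, so dividing by it is
   meaningful: it is at least
   (sqrt tau - sqrt sigma r)^2 + (chi + sigma r) (u - r) >= 0,
   and if this bound is 0 then chi = sigma = tau = 0, gamma < 0 and the value
   is - gamma r. *)
Definition qh_c {R : realType} (tau sigma gamma chi r u : R) : R :=
  tau + sigma * r * u - gamma * r + chi * u.

Definition qh_Q {R : realType} (theta eta tau sigma rho chi x y : R) : R :=
  tau * x ^+ 2 + sigma * y ^+ 2 + rho * x * y + theta * x + eta * y + chi.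

(* Main.v *)
Require Import Defs.
From HB Require Import structures.
From mathcomp Require Import all_boot all_order all_algebra.
From mathcomp Require Import all_classical all_reals all_analysis.
From mathcomp Require Import measurable_realfun ring lra.
Set Implicit Arguments.
Unset Strict Implicit.
Unset Printing Implicit Defensive.
Import Order.TTheory GRing.Theory Num.Theory.
Import numFieldNormedType.Exports.
Local Open Scope classical_set_scope.
Local Open Scope ring_scope.

(* Computing E(X_s X_t | F_{r,u}) for r < s < t < u by conditioning first on
   F_{s,u} or first on F_{r,t} shows that
     Var(X_s | F_{r,u}) = (u - s) (s - r) / (u - r) * H_{r,u},
   where H_{r,u} is quadratic in X_r, X_u and does not depend on s.  Comparing
   E(X_s^2 | F_{r,v}) with E(E(X_s^2 | F_{r,u}) | F_{r,v}) gives
   E(H_{r,u} | F_{r,v}) = H_{r,v}, and likewise when r is decreased.  By linear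
   independence this is an identity between coefficients: in the variables
   x = (X_u - X_r)/(u - r) and y = (u X_r - r X_u)/(u - r), whose conditional
   covariance matrix given F_{r,v} is a multiple of H_{r,v}, it says that the
   coefficient vectors of H_{r,u} and H_{r,v} are proportional.  Hence
   H_{r,u} = k_{r,u} Q(x, y) with a fixed quadratic polynomial Q, and E H_{r,u} = 1
   forces k_{r,u} c(r,u) = u - r.  So c never vanishes on 0 < r < u; being affine
   in each variable it has constant sign there, and its limits at the boundary
   give the sign conditions on the parameters. *)

(** * Functions with zero conditional expectation *)

Section centered.
Context {d : measure_display} {T : measurableType d} {R : realType}.
Variable P : probability T R.
Implicit Types (G H : set (set T)) (f g h : T -> R).

(* E(h | <<s G>>) = 0. *)
Definition centered G h : Prop :=
  P.-integrable setT (EFin \o h) /\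
  forall A, <<s G >> A -> (\int[P]_(w in A) (h w)%:E = 0)%E.

Definition smeasurable G g : Prop :=
  measurable_fun setT (g : g_sigma_algebraType G -> R).

Lemma sub_measurable G : G `<=` measurable -> <<s G >> `<=` @measurable _ T.
Proof. by move=> Gm; apply: smallest_sub => //; exact: sigma_algebra_measurable. Qed.

Lemma smeasurable_measurable G g : G `<=` measurable ->
  smeasurable G g -> measurable_fun setT g.
Proof.
move=> Gm mg _ B mB; apply: (sub_measurable Gm).
exact: (mg measurableT B mB).
Qed.

Lemma centeredS G H h : <<s G >> `<=` <<s H >> -> centered H h -> centered G h.
Proof. by move=> GH [ih h0]; split=> // A /GH/h0. Qed.

Lemma centered0 G : centered G (fun=> 0).
Proof.
split; first exact: integrable0.
by move=> A _; exact: integral0.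
Qed.

Lemma integrableZ_EFin (k : R) h : P.-integrable setT (EFin \o h) ->
  P.-integrable setT (EFin \o (fun w => k * h w)).
Proof. by move=> ih; apply: (integrableZl _ k ih). Qed.

Lemma integrableD_EFin f h : P.-integrable setT (EFin \o f) ->
  P.-integrable setT (EFin \o h) ->
  P.-integrable setT (EFin \o (fun w => f w + h w)).
Proof. by move=> i1 i2; apply: (integrableD _ i1 i2). Qed.

Lemma centeredZ G (k : R) h : G `<=` measurable ->
  centered G h -> centered G (fun w => k * h w).
Proof.
move=> Gm [ih h0]; split; first exact: integrableZ_EFin.
move=> A FA; have mA := sub_measurable Gm FA.
under eq_integral do rewrite EFinM.
by rewrite integralZl ?h0 ?mule0//; apply: (integrableS _ _ _ ih).
Qed.

Lemma centeredD G f h : G `<=` measurable ->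
  centered G f -> centered G h -> centered G (fun w => f w + h w).
Proof.
move=> Gm [i1 h1] [i2 h2]; split; first exact: integrableD_EFin.
move=> A FA; have mA := sub_measurable Gm FA.
under eq_integral do rewrite EFinD.
rewrite integralD ?h1 ?h2 ?adde0//.
  by apply: (integrableS _ _ _ i1).
by apply: (integrableS _ _ _ i2).
Qed.

Lemma centered_sum G (I : Type) (s : seq I) (f : I -> T -> R) : G `<=` measurable ->
  (forall i, centered G (f i)) -> centered G (fun w => \sum_(i <- s) f i w).
Proof.
move=> Gm cf; elim: s => [|i s IH].
  under eq_fun do rewrite big_nil; exact: centered0.
by under eq_fun do rewrite big_cons; exact: centeredD.
Qed.

Lemma centered_indic G B h : G `<=` measurable -> <<s G >> B ->
  centered G h -> centered G (fun w => \1_B w * h w).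
Proof.
move=> Gm FB [ih h0]; have mB := sub_measurable Gm FB.
have E : (EFin \o (fun w => \1_B w * h w)) = (EFin \o h) \_ B.
  apply/funext => w /=; rewrite patchE indicE.
  by case: (w \in B); rewrite ?mul1r ?mul0r.
split.
  rewrite E; apply/integrable_restrict => //.
  by rewrite setTI; apply: (integrableS _ _ _ ih).
move=> A FA; have mA := sub_measurable Gm FA.
have -> : (fun w => (\1_B w * h w)%:E) = (EFin \o h) \_ B := E.
rewrite -integral_mkcondr; apply: h0.
exact: (@measurableI _ (g_sigma_algebraType G)).
Qed.

Import HBSimple HBNNSimple.

(** A simple function is a finite combination of indicators of its level sets, which lie in
    [<<s G>>]. *)
Lemma centered_nnsfun G h (s : {nnsfun (g_sigma_algebraType G) >-> R}) :
  G `<=` measurable ->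
  centered G h -> centered G (fun w => s w * h w).
Proof.
move=> Gm ch.
rewrite (_ : (fun w => s w * h w) = (fun w =>
  \sum_(y <- finmap.enum_fset (fset_set (range s))) (y * (\1_(s @^-1` [set y]) w * h w)))).
  apply: centered_sum => // y; apply: centeredZ => //; apply: centered_indic => //.
  exact: (measurable_funPTI s (measurable_set1 y)).
apply/funext => w; rewrite {1}(fimfunE s w) fsbig_finite//= mulr_suml.
by apply: eq_bigr => y _; rewrite mulrA.
Qed.

(** Simple functions increasing to [g] give products with [h] that are dominated by [|g h|] and have
    zero integral over every set of [<<s G>>], so dominated convergence applies. *)
Lemma centeredM_ge0 G g h : G `<=` measurable -> (forall w, 0 <= g w) ->
  smeasurable G g -> P.-integrable setT (EFin \o (fun w => g w * h w)) ->
  centered G h -> centered G (fun w => g w * h w).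
Proof.
move=> Gm g0 mg igh ch; split=> // A FA; have mA := sub_measurable Gm FA.
have /measurable_EFinP mg' := mg.
pose s n := nnsfun_approx (@measurableT _ (g_sigma_algebraType G)) mg' n.
have cs n : centered G (fun w => s n w * h w) by exact: centered_nnsfun.
have iA : P.-integrable A (EFin \o (fun w => g w * h w)).
  by apply: (integrableS _ _ _ igh).
have [] := @dominated_convergence _ _ _ P A mA
  (fun n => EFin \o (fun w => s n w * h w)) (EFin \o (fun w => g w * h w))
  (abse \o (EFin \o (fun w => g w * h w))).
- move=> n; apply: measurable_funTS; exact: measurable_int (cs n).1.
- exact: measurable_int iA.
- apply: aeW => w Aw.
  have /fine_cvgP[_ c] : (fun n => (s n w)%:E) @ \oo --> (g w)%:E.
    apply: (@cvg_nnsfun_approx _ (g_sigma_algebraType G) R setT measurableT _ mg') => //.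
    by move=> x _; rewrite lee_fin.
  apply/fine_cvgP; split; first exact: nearW.
  by apply: cvgMl; exact: c.
- exact: integrable_abse.
- apply: aeW => w n Aw /=; rewrite lee_fin !normrM ler_wpM2r//.
  rewrite !ger0_norm//.
  have := @le_approx _ (g_sigma_algebraType G) R setT (EFin \o g) n w.
  by rewrite /s nnsfun_approxE lee_fin; apply => // x _; rewrite lee_fin.
move=> _ _ c.
have /cvg_lim <- // := c.
under eq_fun => n do rewrite (cs n).2//.
by rewrite lim_cst.
Qed.

(** This is the rule of taking out what is known. Splitting [g] into positive and negative parts
    reduces it to [centeredM_ge0]; each part is bounded by [|g|], which keeps the products
    integrable. *)
Lemma centeredM G g h : G `<=` measurable ->
  smeasurable G g -> P.-integrable setT (EFin \o (fun w => g w * h w)) ->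
  centered G h -> centered G (fun w => g w * h w).
Proof.
move=> Gm mg igh ch.
have mpos : smeasurable G (fun w => Num.max (g w) 0).
  exact: (@measurable_maxr _ (g_sigma_algebraType G)).
have mneg : smeasurable G (fun w => Num.max (- g w) 0).
  apply: (@measurable_maxr _ (g_sigma_algebraType G)) => //.
  exact: measurableT_comp.
have bnd (k : T -> R) : smeasurable G k -> (forall w, `|k w| <= `|g w|) ->
    P.-integrable setT (EFin \o (fun w => k w * h w)).
  move=> mk kg; apply: le_integrable igh => //.
    apply/measurable_EFinP; apply: measurable_funM.
      exact: smeasurable_measurable mk.
    exact/measurable_EFinP/(measurable_int _ ch.1).
  by move=> w _ /=; rewrite lee_fin !normrM ler_wpM2r.
have cp : centered G (fun w => Num.max (g w) 0 * h w).
  apply: centeredM_ge0 => //; first by move=> w; rewrite le_max lexx orbT.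
  by apply: bnd => // w; case: (ltP (g w) 0); rewrite ?normr0.
have cn : centered G (fun w => Num.max (- g w) 0 * h w).
  apply: centeredM_ge0 => //; first by move=> w; rewrite le_max lexx orbT.
  by apply: bnd => // w; case: (ltP (- g w) 0); rewrite ?normr0 ?normrN.
rewrite (_ : (fun w => g w * h w) =
  (fun w => Num.max (g w) 0 * h w + -1 * (Num.max (- g w) 0 * h w))).
  by apply: centeredD => //; exact: centeredZ.
apply/funext => w; case: (ltP (g w) 0) => g1; case: (ltP (- g w) 0) => g2.
- lra.
- ring.
- ring.
- have -> : g w = 0 by lra.
  ring.
Qed.

(** The set where [h >= 0] belongs to [<<s G>>], so |h| = 2 1_{h >= 0} h - h is centered as well;
    its integral over the whole space is then 0. *)
Lemma centered_ae0 G h : G `<=` measurable -> smeasurable G h ->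
  centered G h -> {ae P, forall w, h w = 0}.
Proof.
move=> Gm mh ch; have mhT := smeasurable_measurable Gm mh.
pose B := [set w | 0 <= h w].
have FB : <<s G >> B.
  rewrite -[B]setTI; exact: (@measurable_fun_le _ (g_sigma_algebraType G)).
have cabs : centered G (fun w => `|h w|).
  rewrite (_ : (fun w => `|h w|) = (fun w => 2 * (\1_B w * h w) + -1 * h w)).
    by apply: centeredD => //; apply: centeredZ => //; exact: centered_indic.
  apply/funext => w; rewrite indicE; case: (boolP (w \in B)) => [|/negP].
    by rewrite inE /B /= => h0; rewrite ger0_norm//; lra.
  by rewrite inE /B /= => /negP; rewrite -ltNge => h0; rewrite ltr0_norm//; lra.
have : ae_eq P setT (EFin \o h) (cst 0%E).
  apply/ae_eq_integral_abs => //; first exact/measurable_EFinP.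
  apply: cabs.2; exact: (@measurableT _ (g_sigma_algebraType G)).
by apply: filterS => w /(_ Logic.I) /= -[].
Qed.
End centered.

(** * Sign conditions and scaling of the parameters from the nonvanishing of c *)

Section normalization.
Context {R : realType}.
Implicit Types a b c x y r u tau sigma gamma chi : R.

Lemma affine_ge0_coeffs a b : (forall t, 0 < t -> 0 <= a + b * t) -> 0 <= a /\ 0 <= b.
Proof.
move=> H; split; rewrite leNgt; apply/negP => neg.
  have [b0|b0] := leP b 0; first by have := H 1 ltr01; lra.
  (* At this point the affine function takes the value a/2 < 0. *)
  have t0 : 0 < - a / (2 * b) by apply: divr_gt0; lra.
  have := H _ t0; have -> : a + b * (- a / (2 * b)) = a / 2 by field; lra.
  lra.
have n0 : 0 < - b by lra.
(* Here b t = - |a| - 1, which outweighs a. *)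
have t0 : 0 < (`|a| + 1) / - b by apply: divr_gt0 => //; rewrite ltr_wpDl.
have := H _ t0.
have -> : a + b * ((`|a| + 1) / - b) = a - `|a| - 1 by field; lra.
by have := ler_norm a; lra.
Qed.

(** The first bound is the limit t -> 0. The second comes from t = sqrt a / sqrt c, where a + c t^2
    = 2 sqrt (c a) t; if a or c vanishes, the claim reduces to an affine function. *)
Lemma quadratic_ge0_coeffs a b c : 0 <= c ->
  (forall t, 0 < t -> 0 <= a + b * t + c * t ^+ 2) ->
  0 <= a /\ - b <= 2 * Num.sqrt (c * a).
Proof.
move=> c0 H.
have a0 : 0 <= a.
  rewrite leNgt; apply/negP => neg.
  have nb : 0 <= `|b| by [].
  have d0 : 0 < 2 * (`|b| + c) - a by lra.
  (* This t is at most 1, so the quadratic is at most a + (|b| + c) t = a (1 + t) / 2 < 0. *)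
  pose t := - a / (2 * (`|b| + c) - a).
  have t0 : 0 < t by apply: divr_gt0; lra.
  have t1 : t <= 1 by rewrite ler_pdivrMr//; lra.
  have e : t * (2 * (`|b| + c) - a) = - a by rewrite divfK// gt_eqF.
  have := H t t0; have := ler_norm b.
  by nra.
split=> //; move: a0; rewrite le_eqVlt => /predU1P[a0|a0].
  rewrite -a0 mulr0 sqrtr0 mulr0 oppr_le0.
  have [] // := @affine_ge0_coeffs b c.
  move=> t t0; have := H t t0; rewrite -a0 add0r expr2 mulrA -mulrDl.
  by rewrite pmulr_lge0.
move: c0; rewrite le_eqVlt => /predU1P[c0|c0].
  rewrite -c0 mul0r sqrtr0 mulr0 oppr_le0.
  have [] // := @affine_ge0_coeffs a b.
  by move=> t t0; have := H t t0; rewrite -c0 mul0r addr0.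
have x0 : 0 < Num.sqrt a by rewrite sqrtr_gt0.
have y0 : 0 < Num.sqrt c by rewrite sqrtr_gt0.
rewrite sqrtrM; last exact: ltW.
have E x y : y != 0 ->
    x ^+ 2 + b * (x / y) + y ^+ 2 * (x / y) ^+ 2 = x / y * (2 * (y * x) + b).
  by move=> ?; field.
have := H _ (divr_gt0 x0 y0).
rewrite -[X in X + _ + _](sqr_sqrtr (ltW a0)) -[X in _ + X * _](sqr_sqrtr (ltW c0)).
rewrite E ?gt_eqF//.
by rewrite pmulr_rge0 ?divr_gt0// => ?; lra.
Qed.

Lemma affine_neq0_gt0 a b l m x y : l < x -> x < m -> l < y -> y < m ->
  (forall z, l < z -> z < m -> a + b * z != 0) ->
  0 < a + b * x -> 0 < a + b * y.
Proof.
move=> lx xm ly ym nz px; rewrite ltNge; apply/negP => qy.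
pose p := a + b * x; pose q := a + b * y.
have d0 : 0 < p - q by rewrite /p /q; lra.
(* If the values p at x and q at y satisfied q <= 0 < p, the affine function would vanish at this
   weighted mean of x and y, which lies in (l, m). *)
have /eqP[] : a + b * ((p * y - q * x) / (p - q)) != 0; [apply: nz|].
- by rewrite ltr_pdivlMr// /p /q; nra.
- by rewrite ltr_pdivrMr// /p /q; nra.
- by rewrite /p /q; field; move: d0; rewrite /p /q; lra.
Qed.

(** The path (1, 2), (1, u + 2), (r, u + 2), (r, u) stays in the domain 0 < r < u and changes one
    variable at a time; [qh_c] is affine along each leg and cannot change sign there. *)
Lemma qh_c_gt0 tau sigma gamma chi :
  (forall r u, 0 < r -> r < u -> qh_c tau sigma gamma chi r u != 0) ->
  0 < qh_c tau sigma gamma chi 1 2 ->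
  forall r u, 0 < r -> r < u -> 0 < qh_c tau sigma gamma chi r u.
Proof.
move=> nz p12 r u r0 ru.
have cr x v : qh_c tau sigma gamma chi x v =
    (tau + chi * v) + (sigma * v - gamma) * x by rewrite /qh_c; ring.
have cu x v : qh_c tau sigma gamma chi x v =
    (tau - gamma * x) + (sigma * x + chi) * v by rewrite /qh_c; ring.
have p1 : 0 < qh_c tau sigma gamma chi 1 (u + 2).
  rewrite cu; apply: (@affine_neq0_gt0 _ _ 1 (u + 3) 2); rewrite -?cu//; try lra.
  by move=> z z1 _; rewrite -cu; apply: nz.
have p2 : 0 < qh_c tau sigma gamma chi r (u + 2).
  rewrite cr; apply: (@affine_neq0_gt0 _ _ 0 (u + 2) 1); rewrite -?cr//; try lra.
  by move=> z z1 z2; rewrite -cr; apply: nz.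
rewrite cu; apply: (@affine_neq0_gt0 _ _ r (u + 3) (u + 2)); rewrite -?cu//; try lra.
by move=> z z1 _; rewrite -cu; apply: nz.
Qed.

(** At (t, t + e) the function [qh_c] is affine in e, with intercept tau + (chi - gamma) t + sigma
    t^2 and slope chi + sigma t. Both are nonnegative for all t > 0, which bounds their coefficients
    in turn. *)
Lemma qh_c_gt0_coeffs tau sigma gamma chi :
  (forall r u, 0 < r -> r < u -> 0 < qh_c tau sigma gamma chi r u) ->
  [/\ 0 <= chi, 0 <= sigma, 0 <= tau & gamma <= chi + 2 * Num.sqrt (sigma * tau)].
Proof.
move=> pos.
have H t : 0 < t -> 0 <= tau + (chi - gamma) * t + sigma * t ^+ 2 /\ 0 <= chi + sigma * t.
  move=> t0; apply: affine_ge0_coeffs => e e0.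
  have := pos t (t + e) t0; rewrite ltrDl => /(_ e0) /ltW.
  by congr (0 <= _); rewrite /qh_c; ring.
have [chi0 sigma0] := affine_ge0_coeffs (fun t t0 => (H t t0).2).
have [tau0 g] := quadratic_ge0_coeffs sigma0 (fun t t0 => (H t t0).1).
by split=> //; lra.
Qed.

Lemma qh_c_neq0_normalize tau sigma gamma chi :
  (forall r u, 0 < r -> r < u -> qh_c tau sigma gamma chi r u != 0) ->
  exists2 k, k != 0 &
  [/\ k * chi = 0 \/ k * chi = 1, 0 <= k * sigma, 0 <= k * tau &
      k * gamma <= k * chi + 2 * Num.sqrt ((k * sigma) * (k * tau))].
Proof.
move=> nz.
have qh_cZ k r u : qh_c (k * tau) (k * sigma) (k * gamma) (k * chi) r u =
    k * qh_c tau sigma gamma chi r u by rewrite /qh_c; ring.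
have coeffsZ k : (forall r u, 0 < r -> r < u -> 0 < k * qh_c tau sigma gamma chi r u) ->
    [/\ 0 <= k * chi, 0 <= k * sigma, 0 <= k * tau &
        k * gamma <= k * chi + 2 * Num.sqrt ((k * sigma) * (k * tau))].
  by move=> kpos; apply: qh_c_gt0_coeffs => r u r0 ru; rewrite qh_cZ kpos.
have [k k0 kpos] : exists2 k, k != 0 & forall r u, 0 < r -> r < u ->
    0 < k * qh_c tau sigma gamma chi r u.
  have n12 := nz 1 2 ltr01 (ltr1n _ 2).
  (* With this factor the rescaled value at (1, 2) is a nonzero square, hence positive. *)
  exists (qh_c tau sigma gamma chi 1 2) => // r u r0 ru.
  rewrite -qh_cZ; apply: qh_c_gt0 => //.
    by move=> x v x0 xv; rewrite qh_cZ mulf_neq0// nz.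
  by rewrite qh_cZ -expr2 exprn_even_gt0.
have [chi0|chi_neq0] := eqVneq chi 0.
  exists k => //; have [_ s0 t0 g0] := coeffsZ k kpos.
  by split=> //; left; rewrite chi0 mulr0.
have [ckhi _ _ _] := coeffsZ k kpos.
have kchi : 0 < k * chi by rewrite lt_neqAle ckhi eq_sym mulf_neq0.
(* Since k chi > 0, the factor 1/chi has the sign of k, so it also makes c positive while turning
   chi into 1. *)
have [|_ s0 t0 g0] := coeffsZ chi^-1.
  move=> r u r0 ru; have -> : chi^-1 = k / (k * chi) by field; rewrite chi_neq0 k0.
  by rewrite mulrAC divr_gt0// kpos.
exists chi^-1; first by rewrite invr_eq0.
by split=> //; right; rewrite mulVf.
Qed.

End normalization.

(** * Functional equations for the coefficients of E(X_s^2 | F_{r,u}) and their solution *)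

Section coefficients.
Context {R : realType}.
Implicit Types q r s t u v x y : R.

Definition quadratic (a b c d e f x y : R) : R :=
  a * x ^+ 2 + b * (x * y) + c * y ^+ 2 + d * x + e * y + f.

Definition all_zero (a b c d e f : R) : Prop :=
  [/\ a = 0, b = 0 & c = 0] /\ [/\ d = 0, e = 0 & f = 0].

(** Both (r, u) and (1, 2) extend to the common interval (q, u + 2), first to the right and then to
    the left. Since [W] does not vanish at (1, 2), the factor leading from there to the common
    interval is nonzero and can be inverted. *)
Lemma collinear_intervals (W : nat -> R -> R -> R) :
  (forall r u, 0 < r -> r < u -> exists i, W i r u != 0) ->
  (forall r u v, 0 < r -> r < u -> u < v ->
     exists k, forall i, W i r u = k * W i r v) ->
  (forall q r u, 0 < q -> q < r -> r < u ->
     exists k, forall i, W i r u = k * W i q u) ->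
  forall r u, 0 < r -> r < u -> exists k, forall i, W i r u = k * W i 1 2.
Proof.
move=> nz right left r u r0 ru.
pose q := Num.min r 1 / 2.
have m0 : 0 < Num.min r 1 by rewrite lt_min r0 ltr01.
have q0 : 0 < q by rewrite divr_gt0.
have qr : q < r.
  have : Num.min r 1 <= r by rewrite ge_min lexx.
  by move: m0; rewrite /q; lra.
have q1 : q < 1.
  have : Num.min r 1 <= 1 by rewrite ge_min lexx orbT.
  by move: m0; rewrite /q; lra.
have [|k1 W1] := right r u (u + 2) r0 ru; first lra.
have [|k2 W2] := left q r (u + 2) q0 qr; first lra.
have [|||k3 W3] := right 1 2 (u + 2); [lra|lra|lra|].
have [|k4 W4] := left q 1 (u + 2) q0 q1; first lra.
have k34 : k3 * k4 != 0.
  have [i] := nz 1 2 ltr01 (ltr1n _ 2).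
  by apply: contra_neq => k0; rewrite W3 W4 mulrA k0 mul0r.
exists (k1 * k2 / (k3 * k4)) => i.
rewrite W1 W2 [in RHS]W3 W4; field.
by move: k34; rewrite mulf_eq0 negb_or => /andP[-> ->].
Qed.

(** Here z = 0 is one of the given coefficient equations and k its factor at the wanted difference,
    so that only a rational identity for [field] remains. *)
Lemma eq_of_scaled (k x y z : R) : k != 0 -> z = 0 -> k * (y - x) = z -> x = y.
Proof.
by move=> k0 -> /eqP; rewrite mulf_eq0 (negbTE k0) subr_eq0 => /eqP.
Qed.

Variables A B C D E F : R -> R -> R -> R.

Hypothesis moment : forall r s u, 0 < r -> r < s -> s < u ->
  A s r u * r + B s r u * r + C s r u * u + F s r u = s.

(** These are the coefficients in X_r, X_u of the difference between the two computations of E(X_s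
    X_t | F_{r,u}). *)
Hypothesis interior : forall r s t u, 0 < r -> r < s -> s < t -> t < u ->
  all_zero
    ((u - t) / (u - s) * A s r u - (t - s) / (t - r) * ((u - t) / (u - r))
       - (s - r) / (t - r) * A t r u)
    ((u - t) / (u - s) * B s r u + (t - s) / (u - s) * ((u - s) / (u - r))
       - (t - s) / (t - r) * ((t - r) / (u - r)) - (s - r) / (t - r) * B t r u)
    ((u - t) / (u - s) * C s r u + (t - s) / (u - s) * ((s - r) / (u - r))
       - (s - r) / (t - r) * C t r u)
    ((u - t) / (u - s) * D s r u - (s - r) / (t - r) * D t r u)
    ((u - t) / (u - s) * E s r u - (s - r) / (t - r) * E t r u)
    ((u - t) / (u - s) * F s r u - (s - r) / (t - r) * F t r u).

(** The tower property for F_{r,v} inside F_{r,u}, with X_u, X_r X_u and X_u^2 replaced by their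
    conditional expectations given F_{r,v}. [left_extension] is the mirror image. *)
Hypothesis right_extension : forall r s u v, 0 < r -> r < s -> s < u -> u < v ->
  all_zero
    (A s r v - A s r u - B s r u * ((v - u) / (v - r)) - C s r u * A u r v)
    (B s r v - B s r u * ((u - r) / (v - r)) - C s r u * B u r v)
    (C s r v - C s r u * C u r v)
    (D s r v - D s r u - E s r u * ((v - u) / (v - r)) - C s r u * D u r v)
    (E s r v - E s r u * ((u - r) / (v - r)) - C s r u * E u r v)
    (F s r v - F s r u - C s r u * F u r v).

Hypothesis left_extension : forall q r s u, 0 < q -> q < r -> r < s -> s < u ->
  all_zero
    (A s q u - A s r u * A r q u)
    (B s q u - A s r u * B r q u - B s r u * ((u - r) / (u - q)))
    (C s q u - A s r u * C r q u - B s r u * ((r - q) / (u - q)) - C s r u)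
    (D s q u - A s r u * D r q u - D s r u * ((u - r) / (u - q)))
    (E s q u - A s r u * E r q u - D s r u * ((r - q) / (u - q)) - E s r u)
    (F s q u - A s r u * F r q u - F s r u).

Let mid r u := (r + u) / 2.
Let w r u := (u - mid r u) * (mid r u - r) / (u - r).
(* Coefficients of Var(X_s | F_{r,u}) (u - r) / ((u - s) (s - r)) in
   X_r^2, X_r X_u, X_u^2, X_r, X_u, 1; since they do not depend on s (lemma
   [coeffsE]), they are read off at the midpoint. *)
Let hA r u := (A (mid r u) r u - ((u - mid r u) / (u - r)) ^+ 2) / w r u.
Let hB r u := (B (mid r u) r u
  - 2 * ((u - mid r u) / (u - r)) * ((mid r u - r) / (u - r))) / w r u.
Let hC r u := (C (mid r u) r u - ((mid r u - r) / (u - r)) ^+ 2) / w r u.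
Let hD r u := D (mid r u) r u / w r u.
Let hE r u := E (mid r u) r u / w r u.
Let hF r u := F (mid r u) r u / w r u.

(** Once the coefficients of the squared conditional mean are subtracted, [interior] says that the
    remainder divided by (u - s) (s - r) is the same at two times. One of the two is taken to be the
    midpoint, and the cases follow the order of s and the midpoint. *)
Lemma coeffsE r s u : 0 < r -> r < s -> s < u ->
  [/\ A s r u = ((u - s) / (u - r)) ^+ 2 + (u - s) * (s - r) / (u - r) * hA r u,
      B s r u = 2 * ((u - s) / (u - r)) * ((s - r) / (u - r))
        + (u - s) * (s - r) / (u - r) * hB r u &
      C s r u = ((s - r) / (u - r)) ^+ 2 + (u - s) * (s - r) / (u - r) * hC r u] /\
  [/\ D s r u = (u - s) * (s - r) / (u - r) * hD r u,
      E s r u = (u - s) * (s - r) / (u - r) * hE r u &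
      F s r u = (u - s) * (s - r) / (u - r) * hF r u].
Proof.
move=> r0 rs su.
have n1 : u - mid r u != 0 by rewrite /mid; apply/negP => /eqP; lra.
have n2 : mid r u - r != 0 by rewrite /mid; apply/negP => /eqP; lra.
have n3 : u - r != 0 by apply/negP => /eqP; lra.
have n4 : u - s != 0 by apply/negP => /eqP; lra.
have n5 : s - r != 0 by apply/negP => /eqP; lra.
rewrite /hA /hB /hC /hD /hE /hF /w.
have [sm|ms|->] := ltgtP s (mid r u).
- have mu : mid r u < u by rewrite /mid; lra.
  have [[eA eB eC] [eD eE eF]] := interior r0 rs sm mu.
  move: (mid r u) n1 n2 eA eB eC eD eE eF {sm mu} => m n1 n2 eA eB eC eD eE eF.
  have K : (u - m) / (u - s) != 0 by rewrite mulf_neq0 ?invr_eq0.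
  split; split; apply: esym;
    [apply: (eq_of_scaled K eA)|apply: (eq_of_scaled K eB)|apply: (eq_of_scaled K eC)
    |apply: (eq_of_scaled K eD)|apply: (eq_of_scaled K eE)|apply: (eq_of_scaled K eF)];
    by field; rewrite ?n1 ?n2 ?n3 ?n4 ?n5.
- have rm : r < mid r u by rewrite /mid; lra.
  have [[eA eB eC] [eD eE eF]] := interior r0 rm ms su.
  move: (mid r u) n1 n2 eA eB eC eD eE eF {rm ms} => m n1 n2 eA eB eC eD eE eF.
  have K : - ((m - r) / (s - r)) != 0 by rewrite oppr_eq0 mulf_neq0 ?invr_eq0.
  split; split; apply: esym;
    [apply: (eq_of_scaled K eA)|apply: (eq_of_scaled K eB)|apply: (eq_of_scaled K eC)
    |apply: (eq_of_scaled K eD)|apply: (eq_of_scaled K eE)|apply: (eq_of_scaled K eF)];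
    by field; rewrite ?n1 ?n2 ?n3 ?n4 ?n5.
- by split; split; field; rewrite ?n1 ?n2 ?n3.
Qed.

(* The same polynomial, with coefficients listed in the order of
   x^2, y^2, x y, x, y, 1 for the variables
   x = (X_u - X_r)/(u - r) and y = (u X_r - r X_u)/(u - r), for which
   X_r = y + r x and X_u = y + u x. *)
Let W i r u : R := nth 0
  [:: hA r u * r ^+ 2 + hB r u * (r * u) + hC r u * u ^+ 2;
      hA r u + hB r u + hC r u;
      2 * r * hA r u + (r + u) * hB r u + 2 * u * hC r u;
      r * hD r u + u * hE r u; hD r u + hE r u; hF r u] i.

(** By [right_extension], H_{r,u} with X_u replaced by its linear interpolant between X_r and X_v,
    plus [hC r u] Var(X_u | F_{r,v}), equals H_{r,v}. The variance is a multiple of H_{r,v}, which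
    gives k, and interpolation leaves the slope x and the intercept y unchanged. *)
Lemma coords_right r u v : 0 < r -> r < u -> u < v ->
  exists k, forall i, W i r u = k * W i r v.
Proof.
move=> r0 ru uv; exists (1 - hC r u * ((v - u) * (u - r) / (v - r))).
have rs : r < mid r u by rewrite /mid; lra.
have su : mid r u < u by rewrite /mid; lra.
have [[eA eB eC] [eD eE eF]] := right_extension r0 rs su uv.
have [[e1 e2 e3] [e4 e5 e6]] := coeffsE r0 rs su.
have [[f1 f2 f3] [f4 f5 f6]] := coeffsE r0 rs (lt_trans su uv).
have [[g1 g2 g3] [g4 g5 g6]] := coeffsE r0 ru uv.
move: eA eB eC eD eE eF.
rewrite e1 e2 e3 e4 e5 e6 f1 f2 f3 f4 f5 f6 g1 g2 g3 g4 g5 g6.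
rewrite /W.
move: (mid r u) rs su {e1 e2 e3 e4 e5 e6 f1 f2 f3 f4 f5 f6 g1 g2 g3 g4 g5 g6} => s rs su.
move: (hA r u) (hB r u) (hC r u) (hD r u) (hE r u) (hF r u) => a b c d e f.
move: (hA r v) (hB r v) (hC r v) (hD r v) (hE r v) (hF r v) => a' b' c' d' e' f'.
move=> eA eB eC eD eE eF.
have n1 : u - s != 0 by apply/negP => /eqP; lra.
have n2 : s - r != 0 by apply/negP => /eqP; lra.
have n3 : u - r != 0 by apply/negP => /eqP; lra.
have n4 : v - r != 0 by apply/negP => /eqP; lra.
have K : (s - r) * (u - s) / (u - r) != 0 by rewrite !mulf_neq0 ?invr_eq0.
pose k := 1 - c * ((v - u) * (u - r) / (v - r)).
(* The next six equations compare coefficients: the interpolated H_{r,u} equals k H_{r,v}. *)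
have hf : f = k * f'.
  by apply: (eq_of_scaled K eF); rewrite /k; field; rewrite ?n1 ?n2 ?n3 ?n4.
have hd : d + e * ((v - u) / (v - r)) = k * d'.
  by apply: (eq_of_scaled K eD); rewrite /k; field; rewrite ?n1 ?n2 ?n3 ?n4.
have he : e * ((u - r) / (v - r)) = k * e'.
  by apply: (eq_of_scaled K eE); rewrite /k; field; rewrite ?n1 ?n2 ?n3 ?n4.
have ha : a + b * ((v - u) / (v - r)) + c * ((v - u) / (v - r)) ^+ 2 = k * a'.
  by apply: (eq_of_scaled K eA); rewrite /k; field; rewrite ?n1 ?n2 ?n3 ?n4.
have hb : b * ((u - r) / (v - r))
    + 2 * c * ((v - u) / (v - r)) * ((u - r) / (v - r)) = k * b'.
  by apply: (eq_of_scaled K eB); rewrite /k; field; rewrite ?n1 ?n2 ?n3 ?n4.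
have hc : c * ((u - r) / (v - r)) ^+ 2 = k * c'.
  by apply: (eq_of_scaled K eC); rewrite /k; field; rewrite ?n1 ?n2 ?n3 ?n4.
rewrite -/k; move: k ha hb hc hd he hf {eA eB eC eD eE eF K n1 n2 n3} => k ha hb hc hd he hf.
(* Beyond index 5 both sides are the default value 0 of [nth]. *)
case=> [|[|[|[|[|[|i]]]]]] /=; last by rewrite nth_nil mulr0.
- have -> : k * (a' * r ^+ 2 + b' * (r * v) + c' * v ^+ 2) =
    k * a' * r ^+ 2 + k * b' * (r * v) + k * c' * v ^+ 2 by ring.
  by rewrite -ha -hb -hc; field.
- by rewrite !mulrDr -ha -hb -hc; field.
- have -> : k * (2 * r * a' + (r + v) * b' + 2 * v * c') =
    2 * r * (k * a') + (r + v) * (k * b') + 2 * v * (k * c') by ring.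
  by rewrite -ha -hb -hc; field.
- have -> : k * (r * d' + v * e') = r * (k * d') + v * (k * e') by ring.
  by rewrite -hd -he; field.
- by rewrite !mulrDr -hd -he; field.
- by [].
Qed.

(** Mirror image of [coords_right]: X_r is interpolated between X_q and X_u, and [hA] takes the
    place of [hC]. *)
Lemma coords_left q r u : 0 < q -> q < r -> r < u ->
  exists k, forall i, W i r u = k * W i q u.
Proof.
move=> q0 qr ru; exists (1 - hA r u * ((u - r) * (r - q) / (u - q))).
have r0 := lt_trans q0 qr.
have rs : r < mid r u by rewrite /mid; lra.
have su : mid r u < u by rewrite /mid; lra.
have [[eA eB eC] [eD eE eF]] := left_extension q0 qr rs su.
have [[e1 e2 e3] [e4 e5 e6]] := coeffsE r0 rs su.
have [[f1 f2 f3] [f4 f5 f6]] := coeffsE q0 (lt_trans qr rs) su.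
have [[g1 g2 g3] [g4 g5 g6]] := coeffsE q0 qr ru.
move: eA eB eC eD eE eF.
rewrite e1 e2 e3 e4 e5 e6 f1 f2 f3 f4 f5 f6 g1 g2 g3 g4 g5 g6.
rewrite /W.
move: (mid r u) rs su {e1 e2 e3 e4 e5 e6 f1 f2 f3 f4 f5 f6 g1 g2 g3 g4 g5 g6} => s rs su.
move: (hA r u) (hB r u) (hC r u) (hD r u) (hE r u) (hF r u) => a b c d e f.
move: (hA q u) (hB q u) (hC q u) (hD q u) (hE q u) (hF q u) => a' b' c' d' e' f'.
move=> eA eB eC eD eE eF.
have n1 : u - s != 0 by apply/negP => /eqP; lra.
have n2 : s - r != 0 by apply/negP => /eqP; lra.
have n3 : u - r != 0 by apply/negP => /eqP; lra.
have n4 : u - q != 0 by apply/negP => /eqP; lra.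
have K : (s - r) * (u - s) / (u - r) != 0 by rewrite !mulf_neq0 ?invr_eq0.
pose k := 1 - a * ((u - r) * (r - q) / (u - q)).
have hf : f = k * f'.
  by apply: (eq_of_scaled K eF); rewrite /k; field; rewrite ?n1 ?n2 ?n3 ?n4.
have hd : d * ((u - r) / (u - q)) = k * d'.
  by apply: (eq_of_scaled K eD); rewrite /k; field; rewrite ?n1 ?n2 ?n3 ?n4.
have he : d * ((r - q) / (u - q)) + e = k * e'.
  by apply: (eq_of_scaled K eE); rewrite /k; field; rewrite ?n1 ?n2 ?n3 ?n4.
have ha : a * ((u - r) / (u - q)) ^+ 2 = k * a'.
  by apply: (eq_of_scaled K eA); rewrite /k; field; rewrite ?n1 ?n2 ?n3 ?n4.
have hb : 2 * a * ((u - r) / (u - q)) * ((r - q) / (u - q))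
    + b * ((u - r) / (u - q)) = k * b'.
  by apply: (eq_of_scaled K eB); rewrite /k; field; rewrite ?n1 ?n2 ?n3 ?n4.
have hc : a * ((r - q) / (u - q)) ^+ 2 + b * ((r - q) / (u - q)) + c = k * c'.
  by apply: (eq_of_scaled K eC); rewrite /k; field; rewrite ?n1 ?n2 ?n3 ?n4.
rewrite -/k; move: k ha hb hc hd he hf {eA eB eC eD eE eF K n1 n2 n3} => k ha hb hc hd he hf.
case=> [|[|[|[|[|[|i]]]]]] /=; last by rewrite nth_nil mulr0.
- have -> : k * (a' * q ^+ 2 + b' * (q * u) + c' * u ^+ 2) =
    k * a' * q ^+ 2 + k * b' * (q * u) + k * c' * u ^+ 2 by ring.
  by rewrite -ha -hb -hc; field.
- by rewrite !mulrDr -ha -hb -hc; field.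
- have -> : k * (2 * q * a' + (q + u) * b' + 2 * u * c') =
    2 * q * (k * a') + (q + u) * (k * b') + 2 * u * (k * c') by ring.
  by rewrite -ha -hb -hc; field.
- have -> : k * (q * d' + u * e') = q * (k * d') + u * (k * e') by ring.
  by rewrite -hd -he; field.
- by rewrite !mulrDr -hd -he; field.
- by [].
Qed.

(** This is E H_{r,u} = 1 multiplied by u - r, because E x^2 = 1/(u - r), E y^2 = r u/(u - r), E x y
    = - r/(u - r) and x, y have mean 0. *)
Lemma coords_moment r u : 0 < r -> r < u ->
  W 0 r u + W 1 r u * (r * u) - W 2 r u * r + W 5 r u * (u - r) = u - r.
Proof.
move=> r0 ru.
have rs : r < mid r u by rewrite /mid; lra.
have su : mid r u < u by rewrite /mid; lra.
have := moment r0 rs su.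
have [[-> -> ->] [_ _ ->]] := coeffsE r0 rs su.
move: (mid r u) rs su => s rs su.
rewrite /W /=.
move: (hA r u) (hB r u) (hC r u) (hF r u) => a b c f h.
have n1 : u - s != 0 by apply/negP => /eqP; lra.
have n2 : s - r != 0 by apply/negP => /eqP; lra.
have n3 : u - r != 0 by apply/negP => /eqP; lra.
have K : (s - r) * (u - s) / (u - r) ^+ 2 != 0.
  by rewrite !mulf_neq0 ?invr_eq0 ?sqrf_eq0.
apply: esym; apply: (eq_of_scaled K (subrr s)); rewrite -[X in _ = X - _]h.
by field.
Qed.

Lemma qh_coefficients : exists tau sigma rho theta eta chi,
  forall r u, 0 < r -> r < u -> qh_c tau sigma (rho + chi) chi r u != 0 /\
  forall s x y, r < s -> s < u ->
    quadratic (A s r u) (B s r u) (C s r u) (D s r u) (E s r u) (F s r u) x y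
      - ((u - s) / (u - r) * x + (s - r) / (u - r) * y) ^+ 2 =
    (s - r) * (u - s) / qh_c tau sigma (rho + chi) chi r u *
      qh_Q theta eta tau sigma rho chi ((y - x) / (u - r)) ((u * x - r * y) / (u - r)).
Proof.
have nz r u : 0 < r -> r < u -> exists i, W i r u != 0.
  move=> r0 ru; apply: contrapT => W0.
  have {}W0 i : W i r u = 0.
    by apply/eqP; apply: contrapT => /negP Wi; apply: W0; exists i.
  by have := coords_moment r0 ru; rewrite !W0; lra.
(* Q has the coordinates of H at the reference interval (1, 2). In [coords_moment] the terms - rho r
   and chi (u - r) combine to - (rho + chi) r + chi u, so gamma is rho + chi. *)
exists (W 0 1 2), (W 1 1 2), (W 2 1 2), (W 3 1 2), (W 4 1 2), (W 5 1 2) => r u r0 ru.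
have [k Wk] := collinear_intervals nz coords_right coords_left r0 ru.
have n1 : u - r != 0 by apply/negP => /eqP; lra.
pose c0 := qh_c (W 0 1 2) (W 1 1 2) (W 2 1 2 + W 5 1 2) (W 5 1 2) r u.
have kc : k * c0 = u - r.
  by rewrite -(coords_moment r0 ru) !Wk /c0 /qh_c; ring.
have c_neq0 : c0 != 0 by apply: contra_neq n1 => c00; rewrite -kc c00 mulr0.
split=> // s x y rs su; rewrite -/c0.
have kE : k = (u - r) / c0 by rewrite -kc mulfK.
have -> : (s - r) * (u - s) / c0 * qh_Q (W 3 1 2) (W 4 1 2) (W 0 1 2) (W 1 1 2)
    (W 2 1 2) (W 5 1 2) ((y - x) / (u - r)) ((u * x - r * y) / (u - r)) =
  (s - r) * (u - s) / (u - r) * qh_Q (W 3 r u) (W 4 r u) (W 0 r u) (W 1 r u)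
    (W 2 r u) (W 5 r u) ((y - x) / (u - r)) ((u * x - r * y) / (u - r)).
  by rewrite !Wk kE /qh_Q; field; rewrite n1 c_neq0.
have [[-> -> ->] [-> -> ->]] := coeffsE r0 rs su.
rewrite /W /qh_Q /quadratic /=.
move: (hA r u) (hB r u) (hC r u) (hD r u) (hE r u) (hF r u) => a b c d e f.
by field.
Qed.

End coefficients.

(** * From the quadratic harness to the coefficient equations *)

Section process.
Context {d : measure_display} {T : measurableType d} {R : realType}.
Variables (P : probability T R) (X : R -> {RV P >-> R}).
Implicit Types q r s t u v : R.

(** The generating family of [two_sided_sigma_field], named separately because [centered] takes
    generators. *)
Definition two_sided_generators r u : set (set T) :=
  [set A | exists t (B : set R),
     [/\ 0 <= t <= r \/ u <= t, measurable B & A = X t @^-1` B]]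
  `|` [set N | measurable N /\ P N = 0%E].

Lemma two_sided_generators_measurable r u :
  two_sided_generators r u `<=` measurable.
Proof.
move=> A [[t [B [_ mB ->]]]|[]//].
exact: (measurable_funPTI (X t) mB).
Qed.
Local Notation gm := (@two_sided_generators_measurable _ _).

Lemma sub_two_sided r r' u u' : r <= r' -> u' <= u ->
  <<s two_sided_generators r u >> `<=` <<s two_sided_generators r' u' >>.
Proof.
move=> rr uu; apply: sub_smallest2r; first exact: smallest_sigma_algebra.
move=> A [[t [B [ht mB ->]]]|nA]; [left|by right].
exists t, B; split=> //; case: ht => [/andP[t0 tr]|ut]; [left|right].
  by rewrite t0 (le_trans tr).
exact: le_trans uu ut.
Qed.

Lemma smeasurable_process r u t : 0 <= t <= r \/ u <= t ->
  smeasurable (two_sided_generators r u) (X t).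
Proof.
move=> ht _ B mB; rewrite setTI; apply: sub_sigma_algebra; left.
by exists t, B.
Qed.

Lemma smeasurable_quadratic (G : set (set T)) (a b c e f g : R) (Y Z : T -> R) :
  smeasurable G Y -> smeasurable G Z ->
  smeasurable G (fun w => quadratic a b c e f g (Y w) (Z w)).
Proof.
move=> mY mZ; rewrite /quadratic.
have mM := @measurable_funM _ (g_sigma_algebraType G) R setT.
have mD := @measurable_funD _ (g_sigma_algebraType G) R setT.
have mC (k : R) : @smeasurable _ _ R G (fun=> k) by exact: measurable_cst.
have mX := @measurable_funX _ (g_sigma_algebraType G) R setT.
apply: (mD) => //; apply: (mD); last exact: mM.
apply: (mD); last exact: mM.
apply: (mD); last by apply: mM => //; exact: mX.
apply: (mD); first by apply: mM => //; exact: mX.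
by apply: (mM) => //; apply: (mM).
Qed.

Lemma cond_exp_centered (G : set (set T)) (Z Y : T -> R) : G `<=` measurable ->
  is_cond_exp P <<s G >> Z Y -> centered P G (fun w => Z w - Y w).
Proof.
move=> Gm [iZ iY _ ZY]; split; first exact: (integrableB measurableT iZ iY).
move=> A FA; have mA := sub_measurable Gm FA.
under eq_integral do rewrite EFinB.
have iZA : P.-integrable A (EFin \o Z) by apply: (integrableS _ _ _ iZ).
have iYA : P.-integrable A (EFin \o Y) by apply: (integrableS _ _ _ iY).
rewrite integralB// ZY// subee//.
exact: integrable_fin_num.
Qed.

Definition has_mean (f : T -> R) (m : R) : Prop :=
  P.-integrable setT (EFin \o f) /\ (\int[P]_w (f w)%:E = m%:E)%E.

Lemma has_meanZ (k m : R) (f : T -> R) :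
  has_mean f m -> has_mean (fun w => k * f w) (k * m).
Proof.
move=> [fi fm]; split; first exact: integrableZ_EFin.
by under eq_integral do rewrite EFinM; rewrite integralZl// fm.
Qed.

Lemma has_meanD (m n : R) (f g : T -> R) :
  has_mean f m -> has_mean g n -> has_mean (fun w => f w + g w) (m + n).
Proof.
move=> [fi fm] [gi gn]; split; first exact: integrableD_EFin.
by under eq_integral do rewrite EFinD; rewrite integralD// fm gn.
Qed.

Lemma has_mean_cst (k : R) : has_mean (fun=> k) k.
Proof.
split; first exact: finite_measure_integrable_cst.
rewrite integral_cst// -[RHS]mule1; congr (_ * _)%E; exact: probability_setT.
Qed.

Hypothesis hX : standard_quadratic_harness X.

Lemma integrable_process t : 0 <= t -> P.-integrable setT (EFin \o X t).
Proof. by case: hX => -[_ h _] _ _ _ _; exact: h. Qed.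

Lemma integrable_sqr t : 0 <= t ->
  P.-integrable setT (EFin \o (fun w => X t w ^+ 2)).
Proof. by case: hX => _ h _ _ _; exact: h. Qed.

Lemma integrable_prod s t : 0 <= s -> 0 <= t ->
  P.-integrable setT (EFin \o (fun w => X s w * X t w)).
Proof.
move=> s0 t0.
apply: le_integrable (integrableD_EFin (integrable_sqr s0) (integrable_sqr t0)) => //.
  by apply/measurable_EFinP; exact: measurable_funM.
move=> w _ /=; rewrite lee_fin normrM [leRHS]ger0_norm ?addr_ge0 ?sqr_ge0//.
rewrite -(real_normK (num_real (X s w))) -(real_normK (num_real (X t w))).
have : 0 <= `|X s w| by []. have : 0 <= `|X t w| by [].
by nra.
Qed.

Lemma linear_centered r s u : 0 <= r -> r < s -> s < u ->
  centered P (two_sided_generators r u)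
    (fun w => X s w - ((u - s) / (u - r) * X r w + (s - r) / (u - r) * X u w)).
Proof.
move=> r0 rs su; apply: cond_exp_centered; first exact: gm.
by case: hX => -[_ _ h] _ _ _ _; exact: h.
Qed.

(** For t outside (r, u) the variable X_t is measurable for F_{r,u}, so it can be multiplied into
    [linear_centered]. *)
Lemma prod_linear_centered r s u t : 0 <= r -> r < s -> s < u ->
  0 <= t <= r \/ u <= t ->
  centered P (two_sided_generators r u) (fun w => X t w *
    (X s w - ((u - s) / (u - r) * X r w + (s - r) / (u - r) * X u w))).
Proof.
move=> r0 rs su ht; apply: centeredM; first exact: gm.
- exact: smeasurable_process.
- have s0 : 0 <= s by lra.
  have u0 : 0 <= u by lra.
  have t0 : 0 <= t by case: ht => [/andP[]//|]; lra.
  rewrite (_ : (fun w => _) = (fun w => X t w * X s w +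
      (- ((u - s) / (u - r)) * (X t w * X r w) +
       - ((s - r) / (u - r)) * (X t w * X u w)))).
    apply: integrableD_EFin; first exact: integrable_prod.
    by apply: integrableD_EFin; apply: integrableZ_EFin; exact: integrable_prod.
  by apply/funext => w; ring.
- exact: linear_centered.
Qed.

Variables A B C D E F : R -> R -> R -> R.
Local Notation quad s r u := (quadratic (A s r u) (B s r u) (C s r u)
  (D s r u) (E s r u) (F s r u)).
Hypothesis hquad : forall r s u, 0 <= r -> r < s -> s < u ->
  is_cond_exp P (two_sided_sigma_field X r u) (fun w => X s w ^+ 2)
    (fun w => quad s r u (X r w) (X u w)).

Lemma quad_centered r s u : 0 <= r -> r < s -> s < u ->
  centered P (two_sided_generators r u)
    (fun w => X s w ^+ 2 - quad s r u (X r w) (X u w)).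
Proof.
move=> r0 rs su; apply: cond_exp_centered; first exact: gm.
exact: hquad.
Qed.

Hypothesis hindep : forall r u : R, 0 < r -> r < u ->
  ae_lin_indep P [tuple (fun=> 1); (X r : T -> R); (X u : T -> R);
    (fun w => X r w * X u w); (fun w => X r w ^+ 2); (fun w => X u w ^+ 2)].

Lemma quadratic_ae0 r u a b c e f g : 0 < r -> r < u ->
  {ae P, forall w, quadratic a b c e f g (X r w) (X u w) = 0} ->
  all_zero a b c e f g.
Proof.
move=> r0 ru q0.
(* The order 1, X_r, X_u, X_r X_u, X_r^2, X_u^2 is that of the tuple in [hindep]. *)
pose k (i : 'I_6) := nth 0 [:: g; e; f; b; a; c] i.
have k0 : forall i, k i = 0.
  apply: (hindep r0 ru); apply: filterS q0 => w qw; rewrite -[RHS]qw.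
  rewrite !big_ord_recl big_ord0 /k /quadratic /= !(tnth_nth (fun=> 0)) /=.
  ring.
split; split.
- exact: (k0 (@Ordinal 6 4 isT)).
- exact: (k0 (@Ordinal 6 3 isT)).
- exact: (k0 (@Ordinal 6 5 isT)).
- exact: (k0 (@Ordinal 6 1 isT)).
- exact: (k0 (@Ordinal 6 2 isT)).
- exact: (k0 (@Ordinal 6 0 isT)).
Qed.

(** A polynomial in X_r and X_u is measurable for F_{r,u}, so being centered makes it vanish almost
    surely, and linear independence applies. *)
Lemma quadratic_centered_zero r u a b c e f g : 0 < r -> r < u ->
  centered P (two_sided_generators r u)
    (fun w => quadratic a b c e f g (X r w) (X u w)) ->
  all_zero a b c e f g.
Proof.
move=> r0 ru cq; apply: (quadratic_ae0 r0 ru).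
apply: centered_ae0 cq; first exact: gm.
apply: smeasurable_quadratic; apply: smeasurable_process; [left|by right].
by rewrite lexx ltW.
Qed.

Lemma coeffs_moment r s u : 0 < r -> r < s -> s < u ->
  A s r u * r + B s r u * r + C s r u * u + F s r u = s.
Proof.
move=> r0 rs su.
have [r0' s0 u0] : [/\ 0 <= r, 0 <= s & 0 <= u] by split; lra.
have e1 t : 0 <= t -> has_mean (X t) 0.
  move=> t0; split; first exact: integrable_process.
  by case: hX => _ _ h _ _; have := h t t0; rewrite unlock.
have e2 x y : 0 <= x -> x <= y -> has_mean (fun w => X x w * X y w) x.
  move=> x0 xy; split; first by apply: integrable_prod => //; exact: le_trans xy.
  case: hX => _ _ _ h _; have := h x y x0 (le_trans x0 xy).
  by rewrite unlock (min_idPl xy).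
have c := quad_centered r0' rs su.
have sT : <<s two_sided_generators r u >> setT.
  exact: (@measurableT _ (g_sigma_algebraType _)).
have m0 : has_mean (fun w => X s w ^+ 2 - quad s r u (X r w) (X u w)) 0.
  by split; [exact: c.1|exact: c.2].
have m1 := has_meanD (e2 s s s0 (lexx s))
  (has_meanD (has_meanZ (- A s r u) (e2 r r r0' (lexx r)))
  (has_meanD (has_meanZ (- B s r u) (e2 r u r0' (ltW (lt_trans rs su))))
  (has_meanD (has_meanZ (- C s r u) (e2 u u u0 (lexx u)))
  (has_meanD (has_meanZ (- D s r u) (e1 r r0'))
  (has_meanD (has_meanZ (- E s r u) (e1 u u0)) (has_mean_cst (- F s r u))))))).
have [_] := m0; have [_] := m1.
under eq_integral => w _.
  rewrite (_ : _ + _ = X s w ^+ 2 - quad s r u (X r w) (X u w)); last first.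
    by rewrite /quadratic; ring.
  over.
move=> -> [h]; lra.
Qed.

Lemma coeffs_interior r s t u : 0 < r -> r < s -> s < t -> t < u ->
  all_zero
    ((u - t) / (u - s) * A s r u - (t - s) / (t - r) * ((u - t) / (u - r))
       - (s - r) / (t - r) * A t r u)
    ((u - t) / (u - s) * B s r u + (t - s) / (u - s) * ((u - s) / (u - r))
       - (t - s) / (t - r) * ((t - r) / (u - r)) - (s - r) / (t - r) * B t r u)
    ((u - t) / (u - s) * C s r u + (t - s) / (u - s) * ((s - r) / (u - r))
       - (s - r) / (t - r) * C t r u)
    ((u - t) / (u - s) * D s r u - (s - r) / (t - r) * D t r u)
    ((u - t) / (u - s) * E s r u - (s - r) / (t - r) * E t r u)
    ((u - t) / (u - s) * F s r u - (s - r) / (t - r) * F t r u).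
Proof.
move=> r0 rs st tu.
have [r0' s0 t0] : [/\ 0 <= r, 0 <= s & 0 <= t] by split; lra.
have [su rt ru] : [/\ s < u, r < t & r < u] by split; lra.
apply: (quadratic_centered_zero r0 ru).
(* E(X_s X_t | F_{r,u}), conditioning first on F_{s,u} and on F_{r,t}. *)
have c1 : centered P (two_sided_generators r u) (fun w => X s w *
    (X t w - ((u - t) / (u - s) * X s w + (t - s) / (u - s) * X u w))).
  apply: (centeredS (sub_two_sided (ltW rs) (lexx u))).
  by apply: prod_linear_centered => //; left; rewrite s0 lexx.
have c2 : centered P (two_sided_generators r u) (fun w => X t w *
    (X s w - ((t - s) / (t - r) * X r w + (s - r) / (t - r) * X t w))).
  apply: (centeredS (sub_two_sided (lexx r) (ltW tu))).
  by apply: prod_linear_centered => //; right.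
have c3 := prod_linear_centered r0' rs su (or_intror (lexx u)).
have c4 : centered P (two_sided_generators r u) (fun w => X r w *
    (X t w - ((u - t) / (u - r) * X r w + (t - r) / (u - r) * X u w))).
  by apply: prod_linear_centered => //; left; rewrite r0' lexx.
have c5 := quad_centered r0' rs su.
have c6 := quad_centered r0' rt tu.
have g := @two_sided_generators_measurable r u.
(* In c2 - c1 the product X_s X_t cancels; c3 and c4 eliminate X_s X_u and X_r X_t, and c5 and c6
   eliminate X_s^2 and X_t^2. Only X_r and X_u remain. *)
have := centeredD g (centeredZ (-1) g c1) (centeredD g c2
  (centeredD g (centeredZ (- ((t - s) / (u - s))) g c3)
  (centeredD g (centeredZ ((t - s) / (t - r)) g c4)
  (centeredD g (centeredZ (- ((u - t) / (u - s))) g c5)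
    (centeredZ ((s - r) / (t - r)) g c6))))).
congr (centered _ _ _); apply/funext => w; rewrite /quadratic.
ring.
Qed.

Lemma coeffs_right r s u v : 0 < r -> r < s -> s < u -> u < v ->
  all_zero
    (A s r v - A s r u - B s r u * ((v - u) / (v - r)) - C s r u * A u r v)
    (B s r v - B s r u * ((u - r) / (v - r)) - C s r u * B u r v)
    (C s r v - C s r u * C u r v)
    (D s r v - D s r u - E s r u * ((v - u) / (v - r)) - C s r u * D u r v)
    (E s r v - E s r u * ((u - r) / (v - r)) - C s r u * E u r v)
    (F s r v - F s r u - C s r u * F u r v).
Proof.
move=> r0 rs su uv; have r0' := ltW r0.
have [sv ru rv] : [/\ s < v, r < u & r < v] by split; lra.
apply: (quadratic_centered_zero r0 rv).
have c1 : centered P (two_sided_generators r v)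
    (fun w => X s w ^+ 2 - quad s r u (X r w) (X u w)).
  apply: (centeredS (sub_two_sided (lexx r) (ltW uv))).
  exact: quad_centered.
have c2 := quad_centered r0' rs sv.
have c3 := quad_centered r0' ru uv.
have c4 := linear_centered r0' ru uv.
have c5 : centered P (two_sided_generators r v) (fun w => X r w *
    (X u w - ((v - u) / (v - r) * X r w + (u - r) / (v - r) * X v w))).
  by apply: prod_linear_centered => //; left; rewrite r0' lexx.
have g := @two_sided_generators_measurable r v.
(* In c1 - c2 the square X_s^2 cancels; c3, c4 and c5 eliminate X_u^2, X_u and X_r X_u. *)
have := centeredD g c1 (centeredD g (centeredZ (-1) g c2)
  (centeredD g (centeredZ (C s r u) g c3)
  (centeredD g (centeredZ (E s r u) g c4) (centeredZ (B s r u) g c5)))).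
congr (centered _ _ _); apply/funext => w; rewrite /quadratic.
ring.
Qed.

Lemma coeffs_left q r s u : 0 < q -> q < r -> r < s -> s < u ->
  all_zero
    (A s q u - A s r u * A r q u)
    (B s q u - A s r u * B r q u - B s r u * ((u - r) / (u - q)))
    (C s q u - A s r u * C r q u - B s r u * ((r - q) / (u - q)) - C s r u)
    (D s q u - A s r u * D r q u - D s r u * ((u - r) / (u - q)))
    (E s q u - A s r u * E r q u - D s r u * ((r - q) / (u - q)) - E s r u)
    (F s q u - A s r u * F r q u - F s r u).
Proof.
move=> q0 qr rs su; have q0' := ltW q0.
have [qs ru qu r0] : [/\ q < s, r < u, q < u & 0 <= r] by split; lra.
apply: (quadratic_centered_zero q0 qu).
have c1 : centered P (two_sided_generators q u)
    (fun w => X s w ^+ 2 - quad s r u (X r w) (X u w)).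
  apply: (centeredS (sub_two_sided (ltW qr) (lexx u))).
  exact: quad_centered.
have c2 := quad_centered q0' qs su.
have c3 := quad_centered q0' qr ru.
have c4 := linear_centered q0' qr ru.
have c5 := prod_linear_centered q0' qr ru (or_intror (lexx u)).
have g := @two_sided_generators_measurable q u.
(* Here c3, c4 and c5 eliminate X_r^2, X_r and X_r X_u. *)
have := centeredD g c1 (centeredD g (centeredZ (-1) g c2)
  (centeredD g (centeredZ (A s r u) g c3)
  (centeredD g (centeredZ (D s r u) g c4) (centeredZ (B s r u) g c5)))).
congr (centered _ _ _); apply/funext => w; rewrite /quadratic.
ring.
Qed.

End process.

(** * Assembly and normalization of the parameters *)

Theorem theorem4p4 (d : measure_display) (T : measurableType d) (R : realType)
    (P : probability T R) (X : R -> {RV P >-> R})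
    (hX : standard_quadratic_harness X)
    (hindep : forall r u : R, 0 < r -> r < u ->
       ae_lin_indep P [tuple (fun=> 1); (X r : T -> R); (X u : T -> R);
         (fun w => X r w * X u w); (fun w => X r w ^+ 2);
         (fun w => X u w ^+ 2)]) :
  exists chi sigma tau gamma eta theta : R,
    (chi = 0 \/ chi = 1) /\ 0 <= sigma /\ 0 <= tau /\
    gamma <= chi + 2 * Num.sqrt (sigma * tau) /\
    ~ (gamma = 0 /\ sigma = 0 /\ tau = 0 /\ chi = 0) /\
    forall r s u : R, 0 < r -> r < s -> s < u ->
      is_cond_var P (two_sided_sigma_field X r u) (X s)
        (fun w => (s - r) * (u - s) / qh_c tau sigma gamma chi r u *
           qh_Q theta eta tau sigma (gamma - chi) chi
             ((X u w - X r w) / (u - r))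
             ((u * X r w - r * X u w) / (u - r))).
Proof.
have [[_ _ hlin] _ _ _ [A [B [C [D [E [F hquad]]]]]]] := hX.
have [tau [sigma [rho [theta [eta [chi hV]]]]]] := qh_coefficients
  (coeffs_moment hX hquad) (coeffs_interior hX hquad hindep)
  (coeffs_right hX hquad hindep) (coeffs_left hX hquad hindep).
have [k k0 [chi01 sigma0 tau0 gamma_le]] :=
  qh_c_neq0_normalize (fun r u r0 ru => (hV r u r0 ru).1).
(* Scaling all parameters by k multiplies both Q and c by k and leaves their quotient unchanged. *)
exists (k * chi), (k * sigma), (k * tau), (k * (rho + chi)), (k * eta), (k * theta).
do 4!split=> //.
split.
  (* If all four parameters vanished, so would c(1, 2). *)
  case=> g0 [s0 [t0 c0]].
  have /eqP[] := mulf_neq0 k0 (hV 1 2 ltr01 (ltr1n _ 2)).1.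
  have -> : k * qh_c tau sigma (rho + chi) chi 1 2 = k * tau + k * sigma * 2
    - k * (rho + chi) + k * chi * 2 by rewrite /qh_c; ring.
  by rewrite g0 s0 t0 c0; ring.
move=> r s u r0 rs su; have r0' := ltW r0; have ru := lt_trans rs su.
exists (fun w => (u - s) / (u - r) * X r w + (s - r) / (u - r) * X u w),
  (fun w => quadratic (A s r u) (B s r u) (C s r u) (D s r u) (E s r u) (F s r u)
     (X r w) (X u w)).
split; [exact: hlin|exact: hquad|apply: aeW => w].
have [c_neq0 V] := hV r u r0 ru; rewrite V//.
have -> : qh_c (k * tau) (k * sigma) (k * (rho + chi)) (k * chi) r u =
  k * qh_c tau sigma (rho + chi) chi r u by rewrite /qh_c; ring.
move: (qh_c tau _ _ _ _ _) c_neq0 => c c_neq0.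
rewrite /qh_Q; field; rewrite k0 c_neq0 /=.
by rewrite subr_eq0 gt_eqF.
Qed.
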